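(* Let $k\geq 2$, $\ell_1\geq 3$, $\ell_2\geq 2$ and $r\geq \ell_1+\ell_2+k-1$ be integers, and let $\ell_{\max}=\max\{\ell_1,\ell_2\}$, $\ell_{\min}=\min\{\ell_1,\ell_2\}$. Then there is a constant $C$ depending only on $\ell_1,\ell_2,k,r$ such that for all sufficiently large $n$, $$ (\ell_{\min}-1)\left\lfloor\frac{n-k+1}{r-k+2}\right\rfloor\leq {\rm ex}_r(n,{\rm Berge}\text{-}P_{\ell_1}\cup (k-1)S_{\ell_2})\leq \frac{(\ell_{\max}-1)n}{r-k+2}+C. $$
   Context: An $r$-graph is a hypergraph whose hyperedges are distinct $r$-element subsets of the vertex set. For a graph $F$, an $r$-graph $H$ is a Berge-$F$ if there is a bijection $\phi:E(F)\to E(H)$ with $e\subseteq\phi(e)$ for each $e\in E(F)$; an $r$-graph contains a Berge-$F$ if some subhypergraph is a Berge-$F$. ${\rm ex}_r(n,{\rm Berge}\text{-}F)$ is the maximum number of hyperedges in an $n$-vertex $r$-graph containing no Berge-$F$. $P_m$ is the path with $m$ edges, $S_m$ the star with $m$ edges; $\cup$ is vertex-disjoint union and $cG$ is the disjoint union of $c$ copies of $G$. *)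

(* Defs.v *)
From mathcomp Require Import all_boot all_order all_algebra.

Set Implicit Arguments.
Unset Strict Implicit.
Unset Printing Implicit Defensive.

Record sgraph := SGraph {
  vertex :> finType;
  adj : rel vertex;
  adj_sym : symmetric adj;
  adj_irr : irreflexive adj
}.

Definition edges (G : sgraph) : {set {set G}} :=
  [set [set p.1; p.2] | p : G * G & adj p.1 p.2].

(* P_m: m counts edges, so there are m + 1 vertices. *)
Section Path.
Variable m : nat.

Definition path_adj : rel 'I_m.+1 :=
  fun i j => (i.+1 == j :> nat) || (j.+1 == i :> nat).

Lemma path_adj_sym : symmetric path_adj.
Proof. by move=> i j; rewrite /path_adj orbC. Qed.

Lemma path_adj_irr : irreflexive path_adj.
Proof. by move=> i; rewrite /path_adj orbb gtn_eqF. Qed.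

Definition path_graph : sgraph := SGraph path_adj_sym path_adj_irr.
End Path.

(* S_m: m edges, centre ord0, leaves the m other vertices. *)
Section Star.
Variable m : nat.

Definition star_adj : rel 'I_m.+1 :=
  fun i j => (i == ord0) != (j == ord0).

Lemma star_adj_sym : symmetric star_adj.
Proof. by move=> i j; rewrite /star_adj eq_sym. Qed.

Lemma star_adj_irr : irreflexive star_adj.
Proof. by move=> i; rewrite /star_adj eqxx. Qed.

Definition star_graph : sgraph := SGraph star_adj_sym star_adj_irr.
End Star.

Section DisjointUnion.
Variables G H : sgraph.

Definition dunion_adj : rel (G + H)%type := fun x y =>
  match x, y with
  | inl a, inl b => adj a b
  | inr a, inr b => adj a b
  | _, _ => false
  end.

Lemma dunion_adj_sym : symmetric dunion_adj.
Proof. by move=> [a|a] [b|b] //=; rewrite adj_sym. Qed.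

Lemma dunion_adj_irr : irreflexive dunion_adj.
Proof. by move=> [a|a] /=; rewrite adj_irr. Qed.

Definition dunion : sgraph := SGraph dunion_adj_sym dunion_adj_irr.
End DisjointUnion.

Section Copies.
Variables (c : nat) (G : sgraph).

Definition copies_adj : rel ('I_c * G)%type :=
  fun x y => (x.1 == y.1) && adj x.2 y.2.

Lemma copies_adj_sym : symmetric copies_adj.
Proof. by move=> x y; rewrite /copies_adj eq_sym adj_sym. Qed.

Lemma copies_adj_irr : irreflexive copies_adj.
Proof. by move=> x; rewrite /copies_adj adj_irr andbF. Qed.

Definition copies : sgraph := SGraph copies_adj_sym copies_adj_irr.
End Copies.

Section Berge.
Variable V : finType.

(* A hypergraph on V is its set of hyperedges. *)
Definition uniform (r : nat) (H : {set {set V}}) : bool :=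
  [forall e in H, #|e| == r].

(* The injection f places the vertices of F in V, so that "e is contained in
   phi(e)" makes sense; phi restricts to a bijection from E(F) onto H. *)
Definition is_berge (F : sgraph) (H : {set {set V}}) : bool :=
  [exists f : {ffun F -> V}, exists phi : {ffun {set F} -> {set V}},
    [&& injectiveb f, dinjectiveb phi (mem (edges F)), phi @: edges F == H
      & [forall e in edges F, f @: e \subset phi e]]].

Definition contains_berge (F : sgraph) (H : {set {set V}}) : bool :=
  [exists H' : {set {set V}}, (H' \subset H) && is_berge F H'].
End Berge.

Definition ex_berge (r n : nat) (F : sgraph) : nat :=
  \max_(H : {set {set 'I_n}} | uniform r H && ~~ contains_berge F H) #|H|.

(* Main.v *)
Require Import Defs.
From mathcomp Require Import all_boot all_order all_algebra.
From mathcomp Require Import zify.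

Set Implicit Arguments.
Unset Strict Implicit.
Unset Printing Implicit Defensive.

Import Order.TTheory GRing.Theory Num.Theory.

(** Put [s = r - k + 2].

    Lower bound: fix a core of [k - 1] vertices and cut the rest into blocks of
    [s] vertices; the hyperedges are the core together with a block minus one of
    [min l1 l2 - 1] chosen vertices of that block.  One of the [k] components of a
    Berge copy avoids the core, hence lives in a single block, which has too few
    hyperedges.

    Upper bound: the key estimate is a Gyori-Katona-Lemons type bound
    [s |F| <= (l - 1) |V|] for hyperedges of size at least [s - 1], any two of
    which cover [s] vertices, without a Berge path of length [l].  In a minimal
    counterexample every vertex set [S] meets more than [(l - 1) |S| / s]
    hyperedges.  Hence a longest Berge path has fewer than [s] possible end
    vertices, so it does not close up into a cycle, and by rotations each of its
    two end hyperedges contains at least half of its length in vertices of the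
    path.  Then two chords cross, and rotating once more around the resulting
    cycle contradicts expansion.

    Call a vertex heavy if its degree exceeds a suitable constant.  If there are
    at most [k - 2] heavy vertices, hyperedges keep at least [s] light vertices,
    and a path and then [k - 1] stars can be chosen greedily, discarding each time
    the boundedly many hyperedges through the light vertices in use.  Otherwise
    remove [k - 1] heavy vertices, find a path, and use the removed vertices as
    centres of the stars; distinct hyperedges still cover [s] of the remaining
    vertices. *)

Section SeqNeighbours.
Variable T : eqType.
Implicit Types (w : seq T) (x y : T).

Lemma next_cat_cons2 w1 w2 x y :
  uniq (w1 ++ [:: x, y & w2]) -> next (w1 ++ [:: x, y & w2]) x = y.
Proof.
by move=> uw; rewrite -(next_rot (size w1)) // rot_size_cat /= eqxx.
Qed.

Lemma cat_next w x z : uniq w -> x \in w -> x != last z w ->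
  exists w1 w2, w = w1 ++ [:: x, next w x & w2].
Proof.
move=> uw /splitPr def_w; case: def_w uw => w1 [|y w2] uw.
  by rewrite last_cat eqxx.
by exists w1, w2; rewrite next_cat_cons2.
Qed.

Lemma next_last w x : uniq (x :: w) -> next (x :: w) (last x w) = x.
Proof.
case/lastP: w => [|w y] uw; first by rewrite /= eqxx.
rewrite last_rcons -rcons_cons -rot1_cons next_rot /= ?eqxx //.
by move: uw; rewrite -rcons_cons rcons_uniq.
Qed.

End SeqNeighbours.

Section SymmetricRelations.
Variables (T : eqType) (e : rel T).
Hypothesis e_sym : symmetric e.
Implicit Types (w : seq T) (x y z : T).

Lemma rev_path_sym x w : path e (last x w) (rev (belast x w)) = path e x w.
Proof. by rewrite rev_path; apply: eq_path => y z; rewrite e_sym. Qed.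

Lemma rev_sorted_sym w : sorted e (rev w) = sorted e w.
Proof. by rewrite rev_sorted; apply: eq_sorted => y z; rewrite e_sym. Qed.

(* Posa's rotation along the chord from [x] to the last element *)
Lemma sorted_rotation w1 w2 x :
  sorted e (w1 ++ x :: w2) -> e x (last x w2) -> sorted e (w1 ++ x :: rev w2).
Proof.
rewrite !sorted_cat_cons => /andP[-> pw2] chord /=.
case/lastP: w2 => // w2 z in pw2 chord *.
rewrite last_rcons in chord; rewrite rev_rcons /= chord.
move: pw2; rewrite -rev_path_sym belast_rcons last_rcons rev_cons rcons_path.
by case/andP.
Qed.

Lemma cycle_crossing_chords w1 w2 x y z :
  sorted e (w1 ++ [:: x, y, z & w2]) ->
  e (last z w2) x -> e z (head x w1) -> cycle e (z :: w2 ++ x :: rev w1).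
Proof.
rewrite sorted_cat_cons => /andP[sw1 /= /and3P[_ _ pw2]] ex ez.
rewrite rcons_cat cat_path pw2 /= ex.
have := sw1; rewrite -rev_sorted_sym rev_rcons /= rcons_path => ->.
by case: w1 ez {sw1} => [|u w1] /=; rewrite e_sym // rev_cons last_rcons.
Qed.

End SymmetricRelations.

Lemma leq_card_setU_add (T : finType) (A B : {set T}) n :
  #|B| <= n -> #|A :|: B| <= #|A| + n.
Proof. by move=> Bn; rewrite (leq_trans (leq_card_setU A B)) ?leq_add2l. Qed.

Lemma leq_card_preim_imset (aT bT rT : finType) (g : aT -> rT) (h : bT -> rT)
    (S : {set aT}) :
  injective g -> {in S, forall x, exists y, g x = h y} ->
  #|S| <= #|h @^-1: (g @: S)|.
Proof.
move=> g_inj gS; rewrite -(card_imset _ g_inj).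
apply: leq_trans (leq_imset_card h _); apply/subset_leq_card/subsetP.
move=> _ /imsetP[x xS ->]; have [y def_y] := gS x xS.
by apply/imsetP; exists y; rewrite // inE -def_y imset_f.
Qed.

(** * Simple paths of the incidence graph *)

Section IncidencePaths.
Variables (V E : finType) (tau : E -> {set V}).
Implicit Types (w c : seq (V + E)) (e f : E) (v : V) (z : V + E).

Definition incident : rel (V + E) := fun y z =>
  match y, z with
  | inl v, inr e | inr e, inl v => v \in tau e
  | _, _ => false
  end.

Lemma incident_sym : symmetric incident.
Proof. by case=> [v|e] [w|f]. Qed.

Lemma incident_vertexP v z :
  reflect (exists2 e, z = inr e & v \in tau e) (incident (inl v) z).
Proof.
case: z => [u|e]; first by right=> -[].
by apply: (iffP idP) => [|[_ [->]]] //; exists e.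
Qed.

Lemma incident_edgeP e z :
  reflect (exists2 v, z = inl v & v \in tau e) (incident (inr e) z).
Proof.
case: z => [u|f]; last by right=> -[].
by apply: (iffP idP) => [|[_ [->]]] //; exists u.
Qed.

Definition edge_set w : {set E} := [set e | inr e \in w].
Definition vertex_set w : {set V} := [set v | inl v \in w].

Lemma eq_edge_set w1 w2 : w1 =i w2 -> edge_set w1 = edge_set w2.
Proof. by move=> w12; apply/setP => e; rewrite !inE w12. Qed.

Lemma edge_set_cons_vertex w v : edge_set (inl v :: w) = edge_set w.
Proof. by apply/setP => e; rewrite !inE. Qed.

Lemma edge_set_rcons_vertex w v : edge_set (rcons w (inl v)) = edge_set w.
Proof. by apply/setP => e; rewrite !inE mem_rcons inE. Qed.

Lemma edge_set_rcons_edge w e : edge_set (rcons w (inr e)) = e |: edge_set w.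
Proof. by apply/setP => f; rewrite !inE mem_rcons inE. Qed.

Definition vertices w : seq V :=
  pmap (fun z => if z is inl v then Some v else None) w.
Definition hyperedges w : seq E :=
  pmap (fun z => if z is inr e then Some e else None) w.

Lemma mem_vertices w v : (v \in vertices w) = (inl v \in w).
Proof. by rewrite (@can2_mem_pmap _ _ _ inl) // => -[]. Qed.

Lemma mem_hyperedges w e : (e \in hyperedges w) = (inr e \in w).
Proof. by rewrite (@can2_mem_pmap _ _ _ inr) // => -[]. Qed.

Lemma vertices_uniq w : uniq w -> uniq (vertices w).
Proof. by apply: (@pmap_uniq _ _ _ inl) => -[]. Qed.

Lemma hyperedges_uniq w : uniq w -> uniq (hyperedges w).
Proof. by apply: (@pmap_uniq _ _ _ inr) => -[]. Qed.

Lemma card_edge_set w : uniq w -> #|edge_set w| = size (hyperedges w).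
Proof.
move=> /hyperedges_uniq/card_uniqP <-.
by apply: eq_card => e; rewrite inE mem_hyperedges.
Qed.

Lemma card_vertex_set w : uniq w -> #|vertex_set w| = size (vertices w).
Proof.
move=> /vertices_uniq/card_uniqP <-.
by apply: eq_card => v; rewrite inE mem_vertices.
Qed.

Lemma size_vertices_path z w : path incident z w ->
  size (vertices (z :: w)) <= (size (hyperedges (z :: w))).+1.
Proof.
suff: path incident z w ->
    size (vertices (z :: w)) <=
      size (hyperedges (z :: w)) + (if z is inl _ then 1 else 0).
  by case: z => [v|e] le_w /le_w; rewrite /=; lia.
elim: w z => [|y w IHw] [v|e] //= /andP[].
- by case: y => // f _ /IHw /=; lia.
- by case: y => // u _ /IHw /=; lia.
Qed.

Lemma nth_incident v0 e0 p v u :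
  path incident (inl v) p -> last (inl v) p = inl u ->
  size (vertices p) = size (hyperedges p) /\
  forall i, i < size (hyperedges p) ->
    nth v0 (v :: vertices p) i \in tau (nth e0 (hyperedges p) i) /\
    nth v0 (vertices p) i \in tau (nth e0 (hyperedges p) i).
Proof.
have [n] := ubnP (size p); elim: n p v => // n IHn [|z p] v //= size_p.
case/andP=> /incident_vertexP[e -> ve].
case: p size_p => // y p size_p /andP[/incident_edgeP[x -> xe] path_p] last_p.
have [|size_eq IHp] := IHn p x _ path_p last_p; first by move: size_p => /=; lia.
by split=> [|[|i] //]; [rewrite /= size_eq | apply: IHp].
Qed.

Variable F : {set E}.

(* A Berge path, possibly lacking one or both of its end vertices, seen as a
   simple path of the incidence graph. *)
Definition ipath w := [&& sorted incident w, uniq w & edge_set w \subset F].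

Lemma ipath_rev w : ipath (rev w) = ipath w.
Proof.
rewrite /ipath rev_sorted_sym ?rev_uniq; last exact: incident_sym.
by rewrite (eq_edge_set (mem_rev w)).
Qed.

Lemma ipath_rcons w y z : ipath (rcons w y) -> incident y z -> z \notin rcons w y ->
  edge_set [:: z] \subset F -> ipath (rcons (rcons w y) z).
Proof.
move=> /and3P[sw uw Fw] yz zw Fz; apply/and3P; split.
- by case: w sw {uw Fw zw} => [|x w] /= sw; rewrite ?yz // rcons_path sw last_rcons.
- by rewrite rcons_uniq zw.
- apply/subsetP => e; rewrite inE mem_rcons inE => /predU1P[ez|ew].
    by apply: (subsetP Fz); rewrite inE -ez inE.
  by apply: (subsetP Fw); rewrite inE.
Qed.

Lemma ipath_rcons_vertex w e v : ipath (rcons w (inr e)) -> v \in tau e ->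
  inl v \notin rcons w (inr e) -> ipath (rcons (rcons w (inr e)) (inl v)).
Proof.
move=> iw ve vw; apply: ipath_rcons => //.
by apply/subsetP => f; rewrite !inE.
Qed.

Lemma ipath_rcons_edge w e v : ipath (rcons w (inl v)) -> e \in F -> v \in tau e ->
  e \notin edge_set (rcons w (inl v)) -> ipath (rcons (rcons w (inl v)) (inr e)).
Proof.
move=> iw eF ve; rewrite inE => ew; apply: ipath_rcons => //.
by apply/subsetP => f; rewrite !inE => /eqP[->].
Qed.

Lemma card_vertex_set_ipath w : ipath w -> #|vertex_set w| <= #|edge_set w|.+1.
Proof.
case/and3P=> sw uw _; rewrite card_vertex_set // card_edge_set //.
by case: w sw {uw} => // z w /size_vertices_path.
Qed.

Lemma exists_fresh_vertex w e : ipath w -> #|edge_set w|.+1 < #|tau e| ->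
  exists2 v, v \in tau e & inl v \notin w.
Proof.
move=> /card_vertex_set_ipath le_w lt_e.
have /subsetPn[v ve vw] : ~~ (tau e \subset vertex_set w).
  by apply: contraTN lt_e => /subset_leq_card le_e; rewrite -leqNgt; lia.
by exists v => //; move: vw; rewrite inE.
Qed.

Lemma ipath_of_ucycle c : ucycle incident c -> edge_set c \subset F -> ipath c.
Proof.
case/andP=> cc uc Fc; rewrite /ipath uc Fc !andbT.
by case: c cc {uc Fc} => //= z c; rewrite rcons_path => /andP[].
Qed.

Lemma ucycle_of_ipath a b p v : ipath (inr a :: rcons p (inr b)) ->
  v \in tau a -> v \in tau b -> inl v \notin inr a :: rcons p (inr b) ->
  ucycle incident (inl v :: inr a :: rcons p (inr b)).
Proof.
move=> /and3P[/= sp up _] va vb vp; apply/andP; split; last by rewrite cons_uniq vp.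
by rewrite /= va rcons_path sp last_rcons.
Qed.

Definition has_ipath m :=
  [exists w : {bseq #|{: V + E}| of V + E}, ipath w && (#|edge_set w| == m)].

Lemma has_ipathP m : reflect (exists2 w, ipath w & #|edge_set w| = m) (has_ipath m).
Proof.
apply: (iffP existsP) => [[w /andP[iw /eqP wm]]|[w iw wm]]; first by exists w.
have /and3P[_ uw _] := iw.
have wT : size w <= #|{: V + E}| by rewrite -(card_uniqP uw) max_card.
by exists (Bseq wT); rewrite /= iw wm eqxx.
Qed.

Lemma ipath_cat w1 w2 : ipath (w1 ++ w2) -> ipath w1 /\ ipath w2.
Proof.
case/and3P=> /cat_sorted2[s1 s2]; rewrite cat_uniq => /and3P[u1 _ u2] Fw.
split; [rewrite /ipath s1 u1|rewrite /ipath s2 u2]; apply: subset_trans Fw.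
  by apply/subsetP => e; rewrite !inE mem_cat => ->.
by apply/subsetP => e; rewrite !inE mem_cat orbC => ->.
Qed.

Lemma ipath_trim_head w : ipath w -> edge_set w != set0 ->
  exists w0 a q, w = w0 ++ inr a :: q /\ edge_set (inr a :: q) = edge_set w.
Proof.
case: w => [|[v|a] q] iw /set0Pn[e]; rewrite ?inE //; last by exists [::], a, q.
case: q iw => [|z q] // /and3P[/= /andP[/incident_vertexP[a -> _] _] _ _] _.
by exists [:: inl v], a, q; rewrite edge_set_cons_vertex.
Qed.

Lemma ipath_trim_last w : ipath w -> edge_set w != set0 ->
  exists q b w0, w = rcons q (inr b) ++ w0 /\
    edge_set (rcons q (inr b)) = edge_set w.
Proof.
rewrite -ipath_rev -(eq_edge_set (mem_rev w)) => /ipath_trim_head trim /trim.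
move=> [w0 [b [q [def_w Xw]]]]; exists (rev q), b, (rev w0); split.
  by rewrite -[w]revK def_w rev_cat rev_cons.
by rewrite -Xw -rev_cons; apply: eq_edge_set => z; rewrite mem_rev.
Qed.

Lemma ipath_trim w : ipath w -> 1 < #|edge_set w| -> exists a b p,
  let w' := inr a :: rcons p (inr b) in ipath w' /\ edge_set w' = edge_set w.
Proof.
move=> iw w_gt1; have w_neq0 : edge_set w != set0 by rewrite -card_gt0 ltnW.
have [w0 [a [q [def_w Xq]]]] := ipath_trim_head iw w_neq0.
have [_ iq] : ipath w0 /\ ipath (inr a :: q) by apply: ipath_cat; rewrite -def_w.
rewrite -Xq in w_neq0 w_gt1 *.
have [[|y p] [b [w3 [def_q Xp]]]] := ipath_trim_last iq w_neq0.
  by rewrite -Xp card_edge_set in w_gt1.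
rewrite /= in Xp def_q; case: def_q Xp iq => <- -> Xp iq.
exists a, b, p; split=> //.
by have [] := @ipath_cat (inr a :: rcons p (inr b)) w3 iq.
Qed.

Lemma ipath_rotation w1 w2 z :
  ipath (w1 ++ z :: w2) -> incident z (last z w2) -> ipath (w1 ++ z :: rev w2).
Proof.
move=> /and3P[sw uw Fw] chord.
have perm_w : perm_eq (w1 ++ z :: rev w2) (w1 ++ z :: w2).
  by rewrite perm_cat2l perm_cons perm_rev.
apply/and3P; split; first exact: (sorted_rotation incident_sym).
  by rewrite (perm_uniq perm_w).
by rewrite (eq_edge_set (perm_mem perm_w)).
Qed.

Definition path_end (X : {set E}) v :=
  exists2 w, ipath (rcons w (inl v)) & edge_set (rcons w (inl v)) = X.

Lemma path_end_rcons w e v : ipath (rcons w (inr e)) -> v \in tau e ->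
  inl v \notin rcons w (inr e) -> path_end (edge_set (rcons w (inr e))) v.
Proof.
move=> iw ve vw; exists (rcons w (inr e)); first exact: ipath_rcons_vertex.
exact: edge_set_rcons_vertex.
Qed.

Lemma path_end_ucycle c e v : ucycle incident c -> edge_set c \subset F ->
  e \in edge_set c -> v \in tau e -> path_end (edge_set c) v.
Proof.
move=> uc Fc; rewrite inE => ec ve.
have rot_c z : z \in c -> exists2 w, ipath (rcons w z) & rcons w z =i c.
  move=> zc; have [i w def_c] := rot_to zc; exists w.
    have uw : ucycle incident (rcons w z) by rewrite -rot1_cons -def_c !rot_ucycle.
    apply: ipath_of_ucycle => //; rewrite (@eq_edge_set _ c) // => y.
    by rewrite mem_rcons -def_c mem_rot.
  by move=> y; rewrite mem_rcons -def_c mem_rot.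
have [vc|vc] := boolP (inl v \in c).
  by have [w iw eq_w] := rot_c _ vc; exists w => //; apply: eq_edge_set.
have [w iw eq_w] := rot_c _ ec.
by rewrite -(eq_edge_set eq_w); apply: path_end_rcons; rewrite ?eq_w.
Qed.

Lemma path_end_rotation w b f v : let w' := rcons w (inr b) in
  ipath w' -> v \in tau b -> inl v \notin w' ->
  f \in edge_set w' -> f != b -> v \in tau f ->
  exists2 x, next w' (inr f) = inl x & path_end (edge_set w') x.
Proof.
move=> w' iw' vb vw'; rewrite inE => fw' fb vf.
have [sw' uw' _] := and3P iw'.
have [|w1 [w2 def_w']] := cat_next (z := inr f) uw' fw'.
  by rewrite last_rcons.
move: (next w' _) def_w' => y def_w'; rewrite def_w' in sw'.
have /incident_edgeP[x def_y _] : incident (inr f) y.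
  by move: sw'; rewrite sorted_cat_cons /= => /and3P[].
exists x => //; rewrite def_y in def_w'.
exists (w1 ++ [:: inr f, inl v & rev w2]); last first.
  rewrite edge_set_rcons_vertex def_w'; apply/setP => e.
  by rewrite !inE !mem_cat !inE mem_rev.
rewrite rcons_cat /= -rev_cons -rev_rcons; apply: ipath_rotation.
  by have := ipath_rcons_vertex iw' vb vw'; rewrite -/w' def_w' rcons_cat.
by rewrite last_rcons.
Qed.

Lemma ipath_ucycle_rcons c f v : ucycle incident c -> edge_set c \subset F ->
  f \in F -> f \notin edge_set c -> v \in tau f -> inl v \in c ->
  exists a p, let w := inr a :: rcons p (inr f) in
    [/\ next c (inl v) = inr a, ipath w, edge_set w = f |: edge_set c
      & vertex_set w = vertex_set c].
Proof.
move=> uc Fc fF fc vf vc; have [i [|z q] def_c] := rot_to vc;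
  have uc' := uc; rewrite -(rot_ucycle i) def_c in uc'; case/andP: (uc') => //=.
case/andP=> /incident_vertexP[a def_z _] _ _; rewrite {}def_z in def_c uc'.
have eq_c : rcons (inr a :: q) (inl v) =i c.
  by move=> y; rewrite mem_rcons -def_c mem_rot.
exists a, (rcons q (inl v)); rewrite -2!rcons_cons; split.
- by rewrite -(next_rot i) ?def_c /= ?eqxx //; case/andP: uc.
- apply: ipath_rcons_edge; rewrite ?(eq_edge_set eq_c) //.
  apply: ipath_of_ucycle; rewrite ?(eq_edge_set eq_c) //.
  by rewrite -rot1_cons rot_ucycle.
- by rewrite edge_set_rcons_edge (eq_edge_set eq_c).
- by apply/setP => u; rewrite !in_set mem_rcons in_cons eq_c.
Qed.

Lemma next_vertex w b v : ipath (rcons w (inr b)) -> inl v \in rcons w (inr b) ->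
  exists2 f, next (rcons w (inr b)) (inl v) = inr f & v \in tau f.
Proof.
case/and3P=> sw uw _ vw.
have [|w1 [w2 def_w]] := cat_next (z := inl v) uw vw; first by rewrite last_rcons.
move: sw; rewrite {1}def_w sorted_cat_cons.
by case/and3P=> _ /incident_vertexP[f -> vf] _; exists f.
Qed.

Lemma prev_vertex w a v : ipath (inr a :: w) -> inl v \in inr a :: w ->
  exists f, prev (inr a :: w) (inl v) = inr f.
Proof.
move=> iw vw; have uw : uniq (inr a :: w) by case/and3P: iw.
rewrite -(next_rev uw) rev_cons; have [||f -> _] := @next_vertex (rev w) a v.
- by rewrite -rev_cons ipath_rev.
- by rewrite -rev_cons mem_rev.
by exists f.
Qed.

Lemma ucycle_crossing_chords a b p x y f : let w := inr a :: rcons p (inr b) in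
  ipath w -> x \in tau b -> y \in tau a -> inl x \in w ->
  next w (inl x) = inr f -> next w (inr f) = inl y ->
  exists2 c, ucycle incident c & perm_eq w (inr f :: c).
Proof.
move=> w /and3P[sw uw _] xb ya xw next_x next_f.
have [|w1 [w2]] := cat_next (z := inr a) uw xw; first by rewrite /= last_rcons.
rewrite next_x; case: w2 => [|z w2] def_w.
  have last_w : last (inr a) (rcons p (inr b)) = inr f.
    by rewrite -[LHS]/(last (inr a) w) def_w last_cat.
  by have := next_last uw; rewrite last_w next_f.
have def_z : z = inl y.
  have def_w' : w = (w1 ++ [:: inl x]) ++ [:: inr f, z & w2] by rewrite -catA.
  have := uw; rewrite def_w' => /next_cat_cons2.
  by rewrite -def_w' next_f.
rewrite {z}def_z in def_w.
have head_w : head (inl x) w1 = inr a by case: (w1) def_w => [|u w1'] [->].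
have last_w2 : last (inl y) w2 = inr b.
  by have := congr1 (last (inr a)) def_w; rewrite /= last_rcons last_cat.
have perm_w : perm_eq w (inr f :: inl y :: w2 ++ inl x :: rev w1).
  rewrite def_w; apply/permP => P.
  by rewrite /= !count_cat /= count_rev; lia.
exists (inl y :: w2 ++ inl x :: rev w1) => //; apply/andP; split.
  apply: (cycle_crossing_chords incident_sym (y := inr f)); first by rewrite -def_w.
    by rewrite last_w2.
  by rewrite head_w.
by move: uw; rewrite (perm_uniq perm_w) => /andP[].
Qed.

Lemma exists_crossing_chords a b p : let w := inr a :: rcons p (inr b) in
  ipath w ->
  #|edge_set w| < #|tau a :&: vertex_set w| + #|tau b :&: vertex_set w| ->
  exists x y f, [/\ x \in tau b :&: tau f, y \in tau a, inl x \in w,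
    next w (inl x) = inr f & next w (inr f) = inl y].
Proof.
move=> w iw lt_w; have /and3P[_ uw _] := iw.
pose nexts := inr @^-1: [set next w (inl v) | v in tau b :&: vertex_set w].
pose prevs := inr @^-1: [set prev w (inl v) | v in tau a :&: vertex_set w].
have next_edge v : inl v \in w -> exists2 f, next w (inl v) = inr f & v \in tau f.
  exact: (next_vertex (w := inr a :: p)).
have le_nexts : #|tau b :&: vertex_set w| <= #|nexts|.
  apply: leq_card_preim_imset (inj_comp (can_inj (prev_next uw)) inl_inj) _ => v.
  by rewrite in_setI in_set => /andP[_ /next_edge[f next_v _]]; exists f.
have le_prevs : #|tau a :&: vertex_set w| <= #|prevs|.
  apply: leq_card_preim_imset (inj_comp (can_inj (next_prev uw)) inl_inj) _ => v.
  by rewrite in_setI in_set => /andP[_ /(prev_vertex iw)].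
have sub_w : nexts :|: prevs \subset edge_set w.
  apply/subsetP => f; rewrite in_setU !in_set.
  by case/orP=> /imsetP[v]; rewrite in_setI in_set => /andP[_ vw] ->;
    rewrite ?mem_next ?mem_prev.
have /set0Pn[f] : nexts :&: prevs != set0.
  by have := subset_leq_card sub_w; rewrite -card_gt0 cardsU; lia.
rewrite in_setI !in_set => /andP[/imsetP[x + next_x] /imsetP[y + prev_y]].
rewrite !in_setI !in_set => /andP[xb xw] /andP[ya _].
exists x, y, f; split=> //; last by rewrite prev_y next_prev.
by have [g] := next_edge x xw; rewrite -next_x in_setI xb => -[->].
Qed.

Lemma ipath_cons_vertex w a v : ipath (inr a :: w) -> v \in tau a ->
  inl v \notin inr a :: w -> ipath (inl v :: inr a :: w).
Proof.
move=> iw va vw; rewrite -ipath_rev !rev_cons.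
by apply: ipath_rcons_vertex; rewrite // -rev_cons ?ipath_rev ?mem_rev.
Qed.

Lemma ipath_add_ends w : ipath w -> 1 < #|edge_set w| ->
  {in F, forall e, #|edge_set w|.+1 < #|tau e|} ->
  exists x p y, ipath (inl x :: rcons p (inl y)) /\
    edge_set (inl x :: rcons p (inl y)) = edge_set w.
Proof.
move=> /ipath_trim trim /trim[a [b [p [iw <-]]]] tau_gt.
have /and3P[_ _ /subsetP Fw] := iw.
have [|x xa xw] := exists_fresh_vertex (e := a) iw.
  by apply/tau_gt/Fw; rewrite in_set mem_head.
have iw' := ipath_cons_vertex iw xa xw.
have [|y yb yw] := exists_fresh_vertex (e := b) iw'.
  rewrite edge_set_cons_vertex; apply/tau_gt/Fw.
  by rewrite in_set in_cons mem_rcons mem_head orbT.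
exists x, (rcons (inr a :: p) (inr b)), y; split.
  exact: (ipath_rcons_vertex (w := inl x :: inr a :: p) iw' yb yw).
by rewrite -rcons_cons edge_set_rcons_vertex edge_set_cons_vertex.
Qed.

Definition covered : {set V} := \bigcup_(e in F) tau e.
Definition touching (S : {set V}) : {set E} := [set e in F | tau e :&: S != set0].

Lemma touchingP (S : {set V}) e :
  reflect (e \in F /\ exists2 v, v \in tau e & v \in S) (e \in touching S).
Proof.
rewrite inE; apply: (iffP andP) => -[eF].
  by move=> /set0Pn[v]; rewrite inE => /andP[ve vS]; split=> //; exists v.
by move=> [v ve vS]; split=> //; apply/set0Pn; exists v; rewrite inE ve.
Qed.

Definition expanding (a s : nat) := forall S : {set V},
  S != set0 -> S \subset covered -> a * #|S| < s * #|touching S|.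

Lemma path_end_covered X v : X != set0 -> path_end X v -> v \in covered.
Proof.
move=> X_neq0 [w iw def_X]; rewrite -{}def_X edge_set_rcons_vertex in X_neq0.
case/lastP: w => [|w z] in iw X_neq0 *.
  by case/set0Pn: X_neq0 => e; rewrite inE.
have /and3P[sw _ Fw] := iw.
move: sw; rewrite -cats1 -[rcons w z]cats1 -catA sorted_cat_cons /=.
rewrite incident_sym => /and3P[_ /incident_vertexP[e def_z ve] _].
apply/bigcupP; exists e => //; apply: (subsetP Fw).
by rewrite inE -def_z !mem_rcons inE mem_rcons mem_head orbT.
Qed.

End IncidencePaths.

(** * Longest paths *)

(* In the next two lemmas [on] and [off] count the vertices of the last hyperedge
   of a longest path lying on and off that path, and [N] the hyperedges that meet
   the latter. *)
Lemma leq_half_of_expansion l s on off N : l < s -> N <= on -> s <= (on + off).+1 ->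
  l.-1 * off < s * N -> l <= on.*2.
Proof.
move=> l_lt le_N le_s lt_off; rewrite leqNgt; apply/negP => on_lt.
have off_ge : s.-1 - on <= off by lia.
have le_l : on.*2 * (s.-1 - on) <= l.-1 * (s.-1 - on) by rewrite leq_mul2r; lia.
have le_2s : s * on <= (s.-1 - on).*2 * on by rewrite leq_mul2r; lia.
have : l.-1 * (s.-1 - on) < s * on.
  apply: leq_ltn_trans (leq_trans lt_off _);
    by rewrite leq_mul2l ?off_ge ?le_N orbT.
lia.
Qed.

Lemma expansion_fails l s on off N : l + 3 <= s -> N + on < l -> l <= on.*2 ->
  s <= (on + off).+1 -> s * N <= l.-1 * off.
Proof.
move=> s_ge lt_l le_on le_s.
have le_N : s * N <= s * (l.-1 - on) by rewrite leq_mul2l; lia.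
have le_off : l.-1 * (s.-1 - on) <= l.-1 * off by rewrite leq_mul2l; lia.
nia.
Qed.

Section LongestPath.
Variables (V E : finType) (tau : E -> {set V}) (F : {set E}) (l s m : nat).
Hypotheses (l_ge3 : 3 <= l) (s_ge : l + 3 <= s) (m_gt0 : 0 < m) (m_lt : m < l).
Hypothesis card_tau : {in F, forall e, s <= #|tau e|.+1}.
Hypothesis card_tauU : {in F &, forall e f, e != f -> s <= #|tau e :|: tau f|}.
Hypothesis F_expanding : expanding tau F l.-1 s.
Hypothesis longest : ~~ has_ipath tau F m.+1.
Implicit Types (S : {set V}) (X : {set E}) (w c p : seq (V + E)).

Lemma touching_path_ends X S : #|X| = m -> {in S, forall v, path_end tau F X v} ->
  touching tau F S \subset X.
Proof.
move=> Xm Xend; apply/subsetP => e /touchingP[eF [v ve vS]].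
have [w iw def_X] := Xend v vS; apply: contraR longest => eX.
apply/has_ipathP; exists (rcons (rcons w (inl v)) (inr e)).
  by apply: ipath_rcons_edge; rewrite ?def_X.
by rewrite edge_set_rcons_edge def_X cardsU1 eX Xm.
Qed.

Lemma expanding_path_ends X S : #|X| = m -> {in S, forall v, path_end tau F X v} ->
  S != set0 -> l.-1 * #|S| < s * m.
Proof.
move=> Xm Xend S_neq0; have X_neq0 : X != set0 by rewrite -card_gt0 Xm.
have Scov : S \subset covered tau F.
  by apply/subsetP => v /Xend; apply: path_end_covered.
apply: leq_trans (F_expanding S_neq0 Scov) _.
by rewrite -Xm leq_mul2l subset_leq_card ?orbT // touching_path_ends.
Qed.

Lemma card_path_ends X S :
  #|X| = m -> {in S, forall v, path_end tau F X v} -> #|S| < s.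
Proof.
move=> Xm Xend; have [->|S_neq0] := eqVneq S set0; first by rewrite cards0; lia.
have := expanding_path_ends Xm Xend S_neq0; nia.
Qed.

Lemma longest_gt1 : has_ipath tau F m -> 1 < m.
Proof.
case/has_ipathP=> w iw Xm; rewrite ltn_neqAle m_gt0 andbT; apply/eqP => m1.
have /cards1P[e Xe] : #|edge_set w| == 1 by rewrite Xm m1.
have eF : e \in F by have /and3P[_ _ /subsetP] := iw; apply; rewrite Xe set11.
have tau_neq0 : tau e != set0 by rewrite -card_gt0; have := card_tau eF; lia.
pose we : seq (V + E) := rcons [::] (inr e); have iwe : ipath tau F we.
  by apply/and3P; split=> //; apply/subsetP => f; rewrite inE mem_seq1 => /eqP[->].
have wem : #|edge_set we| = m by rewrite card_edge_set -?m1.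
have tau_end : {in tau e, forall v, path_end tau F (edge_set we) v}.
  by move=> v ve; apply: path_end_rcons.
have := expanding_path_ends wem tau_end tau_neq0; have := card_tau eF; nia.
Qed.

Lemma no_longest_ucycle c : 1 < m -> ucycle (incident tau) c ->
  edge_set c \subset F -> #|edge_set c| != m.
Proof.
move=> m_gt1 uc Fc; apply/eqP => Xm.
have /card_gt1P[e [f [ec fc ef]]] : 1 < #|edge_set c| by rewrite Xm.
have le_s : s <= #|tau e :|: tau f| by apply: card_tauU; rewrite ?(subsetP Fc).
have : #|tau e :|: tau f| < s; last by rewrite ltnNge le_s.
apply: (card_path_ends Xm) => v; rewrite inE => /orP[ve|vf].
  exact: path_end_ucycle ve.
exact: path_end_ucycle vf.
Qed.

Section LastEdge.
Hypothesis m_gt1 : 1 < m.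
Variables (a b : E) (p : seq (V + E)).
Let w := inr a :: rcons p (inr b).
Hypotheses (iw : ipath tau F w) (wm : #|edge_set w| = m).
Let on_path := tau b :&: vertex_set w.
Let off_path := tau b :\: vertex_set w.

Let aF : a \in F.
Proof. by have /and3P[_ _ /subsetP] := iw; apply; rewrite inE mem_head. Qed.

Let bF : b \in F.
Proof.
have /and3P[_ _ /subsetP] := iw; apply.
by rewrite inE in_cons mem_rcons mem_head orbT.
Qed.

Let off_path_end : {in off_path, forall v, path_end tau F (edge_set w) v}.
Proof.
move=> v; rewrite in_setD in_set => /andP[vw vb].
exact: (path_end_rcons (w := inr a :: p) iw vb vw).
Qed.

Lemma touching_off_path : touching tau F off_path \subset edge_set w.
Proof. exact: touching_path_ends wm off_path_end. Qed.

Lemma first_edge_off_path v : v \in tau a -> v \notin off_path.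
Proof.
move=> va; apply/negP; rewrite in_setD in_set => /andP[vw vb].
have /and3P[_ _ Fw] := iw.
have := no_longest_ucycle m_gt1 (ucycle_of_ipath iw va vb vw).
by rewrite edge_set_cons_vertex wm eqxx => /(_ Fw).
Qed.

Lemma first_edge_path_end v :
  v \in tau a -> inl v \notin w -> path_end tau F (edge_set w) v.
Proof.
move=> va vw; have rev_w : rcons (rev (rcons p (inr b))) (inr a) =i w.
  by move=> z; rewrite -rev_cons mem_rev.
rewrite -(eq_edge_set rev_w); apply: path_end_rcons; rewrite ?rev_w //.
by rewrite -rev_cons ipath_rev.
Qed.

Lemma next_touching_off_path f : f \in touching tau F off_path :\ b ->
  exists2 z, next w (inr f) = inl z & path_end tau F (edge_set w) z.
Proof.
rewrite in_setD1 => /andP[fb fN]; have fw := subsetP touching_off_path _ fN.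
have /touchingP[_ [y yf]] := fN; rewrite in_setD in_set => /andP[yw yb].
exact: (path_end_rotation (w := inr a :: p) iw yb yw fw fb yf).
Qed.

(* The vertices following the hyperedges of [touching off_path] on the path, the
   vertices of [off_path] and one more vertex of [a] are all path ends, and there
   are fewer than [s] of those. *)
Lemma card_touching_off_path : #|touching tau F off_path| <= #|on_path|.
Proof.
have [x xa xw] : exists2 x, x \in tau a & inl x \notin w.
  by apply: (exists_fresh_vertex iw); have := card_tau aF; lia.
pose shifted : {set V} :=
  inl @^-1: [set next w (inr f) | f in touching tau F off_path :\ b].
have shiftedP v : v \in shifted -> path_end tau F (edge_set w) v /\ inl v \in w.
  rewrite in_set => /imsetP[f fN].
  have [z next_z z_end] := next_touching_off_path fN.
  rewrite next_z => -[->]; split=> //; rewrite -next_z mem_next.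
  move: fN; rewrite in_setD1 => /andP[_ /(subsetP touching_off_path)].
  by rewrite in_set.
have le_shifted : #|touching tau F off_path :\ b| <= #|shifted|.
  have /and3P[_ uw _] := iw.
  apply: leq_card_preim_imset (inj_comp (can_inj (prev_next uw)) inr_inj) _.
  by move=> f /next_touching_off_path[z next_z _]; exists z.
have disj : off_path :&: shifted = set0.
  apply/setP => v; rewrite in_setI in_set0; apply/negP => /andP[+ /shiftedP[_ vw]].
  by rewrite in_setD in_set vw.
have : #|x |: (off_path :|: shifted)| < s.
  apply: (card_path_ends wm) => v; rewrite in_setU1 in_setU.
  case/or3P=> [/eqP->|/off_path_end//|/shiftedP[]//].
  exact: first_edge_path_end.
have -> : #|x |: (off_path :|: shifted)| = (#|off_path| + #|shifted|).+1.
  rewrite cardsU1 cardsU disj cards0 subn0 in_setU.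
  rewrite (negPf (first_edge_off_path xa)) /=.
  by case: (boolP (x \in shifted)) => // /shiftedP[_ xw']; rewrite xw' in xw.
have := cardsID (vertex_set w) (tau b); have := card_tau bF.
have := cardsD1 b (touching tau F off_path).
rewrite -/on_path -/off_path; lia.
Qed.

Lemma expanding_off_path : l.-1 * #|off_path| < s * #|touching tau F off_path|.
Proof.
apply: F_expanding.
  have [|v vb vw] := exists_fresh_vertex (e := b) iw.
    by have := card_tau bF; lia.
  by apply/set0Pn; exists v; rewrite in_setD in_set vw.
by apply: subset_trans (subsetDl _ _) _; apply: bigcup_sup.
Qed.

Lemma card_on_path_ge : l <= #|on_path|.*2.
Proof.
apply: leq_half_of_expansion card_touching_off_path _ expanding_off_path.
  by lia.
by rewrite cardsID card_tau.
Qed.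

End LastEdge.

(* Cut open next to a vertex of [f], the cycle extends to a longest path ending
   with [f]; a hyperedge that follows such a vertex on the cycle does not meet the
   part of [f] off the cycle. *)
Lemma near_longest_ucycle_off c f v : 1 < m -> ucycle (incident tau) c ->
  edge_set c \subset F -> f \in F -> f \notin edge_set c -> #|edge_set c|.+1 = m ->
  v \in tau f -> inl v \notin c.
Proof.
move=> m_gt1 uc Fc fF fc cm vf; apply/negP => vc.
have open u : u \in tau f :&: vertex_set c -> exists a p,
    let w := inr a :: rcons p (inr f) in [/\ next c (inl u) = inr a, ipath tau F w,
      edge_set w = f |: edge_set c & vertex_set w = vertex_set c].
  by rewrite !inE => /andP[]; apply: ipath_ucycle_rcons.
have fcm : #|f |: edge_set c| = m by rewrite cardsU1 fc add1n.
have [|a [p [_ iw Xw vw]]] := open v; first by rewrite !inE vf.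
rewrite -Xw in fcm; have := touching_off_path iw fcm.
have := expanding_off_path m_gt1 iw fcm; have := card_on_path_ge m_gt1 iw fcm.
rewrite vw Xw; set N := touching tau F _ => le_on lt_off N_sub.
pose nexts := inr @^-1: [set next c (inl u) | u in tau f :&: vertex_set c].
have le_nexts : #|tau f :&: vertex_set c| <= #|nexts|.
  have /andP[_ uniq_c] := uc.
  apply: leq_card_preim_imset (inj_comp (can_inj (prev_next uniq_c)) inl_inj) _.
  by move=> u /open[a' [_ [next_u _ _ _]]]; exists a'.
have nextsP e : e \in nexts -> e \in f |: edge_set c /\ e \notin N.
  rewrite in_set => /imsetP[u /open[a' [p' [-> iw' Xw' vw']]] [->]].
  split; first by rewrite -Xw' in_set mem_head.
  apply/touchingP => -[_ [y ya yoff]].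
  have wm' := fcm; rewrite Xw -Xw' in wm'.
  by have := first_edge_off_path m_gt1 iw' wm' ya; rewrite vw' yoff.
have : #|N :|: nexts| <= m.
  rewrite -fcm Xw subset_leq_card // subUset N_sub.
  by apply/subsetP => e /nextsP[].
have disj : N :&: nexts = set0.
  apply/setP => e; rewrite in_setI in_set0.
  by apply/negP => /andP[eN /nextsP[_]]; rewrite eN.
rewrite cardsU disj cards0 subn0 => le_m.
move: lt_off; rewrite ltnNge => /negP[]; apply: expansion_fails s_ge _ le_on _.
  by lia.
by rewrite cardsID card_tau.
Qed.

(* Chords from the two end hyperedges cross around some hyperedge [f] of the path,
   and reconnecting along them gives a cycle through all hyperedges but [f]. *)
Lemma no_longest_ipath : ~~ has_ipath tau F m.
Proof.
apply/negP => has_m; have m_gt1 := longest_gt1 has_m.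
have /has_ipathP[w0 iw0 w0m] := has_m.
have [|a [b [p]]] := ipath_trim iw0; first by rewrite w0m.
set w := _ :: _ => -[iw Xw0]; have wm : #|edge_set w| = m by rewrite Xw0.
have rev_w : inr b :: rcons (rev p) (inr a) =i w.
  by move=> z; rewrite -rcons_cons -[inr b :: _]rev_rcons -rev_cons mem_rev.
have rev_vw : vertex_set (inr b :: rcons (rev p) (inr a)) = vertex_set w.
  by apply/setP => v; rewrite !in_set rev_w.
have on_a : l <= #|tau a :&: vertex_set w|.*2.
  rewrite -rev_vw.
  apply: card_on_path_ge; rewrite ?(eq_edge_set rev_w) //.
  by rewrite -rcons_cons -[inr b :: _]rev_rcons -rev_cons ipath_rev.
have on_b : l <= #|tau b :&: vertex_set w|.*2 by apply: card_on_path_ge.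
have [|x [y [f [xbf ya xw next_x next_f]]]] := exists_crossing_chords iw.
  by rewrite -/w wm; lia.
have [xb xf] := setIP xbf.
have [c uc perm_w] := ucycle_crossing_chords iw xb ya xw next_x next_f.
have Xw : edge_set w = f |: edge_set c.
  by apply/setP => e; rewrite in_set (perm_mem perm_w) in_cons !inE.
have /and3P[_ uw Fw] := iw.
have fc : f \notin edge_set c.
  by move: uw; rewrite -/w (perm_uniq perm_w) cons_uniq in_set => /andP[].
have /subUsetP[fF Fc] : f |: edge_set c \subset F by rewrite -Xw.
have : inl x \notin c.
  apply: (near_longest_ucycle_off m_gt1 uc Fc _ fc _ xf); first by rewrite -sub1set.
  by rewrite -wm Xw cardsU1 fc.
by move: xw; rewrite (perm_mem perm_w) in_cons => /= ->.
Qed.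

End LongestPath.

Lemma has_ipath_expanding (V E : finType) (tau : E -> {set V}) (F : {set E}) l s :
  3 <= l -> l + 3 <= s -> F != set0 ->
  {in F, forall e, s <= #|tau e|.+1} ->
  {in F &, forall e f, e != f -> s <= #|tau e :|: tau f|} ->
  expanding tau F l.-1 s -> has_ipath tau F l.
Proof.
move=> l_ge3 s_ge /set0Pn[e eF] card_tau card_tauU F_exp.
suff has_m m : 0 < m <= l -> has_ipath tau F m by apply: has_m; lia.
elim: m => // m IHm /andP[_ m_lt]; case: (posnP m) => [->|m_gt0].
  apply/has_ipathP; exists [:: inr e]; last by rewrite card_edge_set.
  by apply/and3P; split=> //; apply/subsetP => f; rewrite inE mem_seq1 => /eqP[->].
have has_m : has_ipath tau F m by apply: IHm; lia.
by apply: contraTT has_m => longest; apply: (no_longest_ipath l_ge3 s_ge).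
Qed.

Lemma exists_expanding (V E : finType) (tau : E -> {set V}) (F : {set E}) a s :
  a * #|covered tau F| < s * #|F| -> exists F' : {set E},
    [/\ F' \subset F, F' != set0 & expanding tau F' a s].
Proof.
pose heavy (F' : {set E}) := a * #|covered tau F'| < s * #|F'|.
move=> /(@minset_exists _ heavy)[F' /minsetP[F'_heavy F'_min] F'F].
exists F'; split=> // [|S S_neq0 Scov].
  by apply: contraTneq F'_heavy => ->; rewrite /heavy cards0 muln0 -leqNgt.
set N := touching tau F' S.
have NF' : N \subset F' by apply/subsetP => e /touchingP[].
have N_neq0 : N != set0.
  have /set0Pn[v vS] := S_neq0; have /bigcupP[e eF' ve] := subsetP Scov v vS.
  by apply/set0Pn; exists e; apply/touchingP; split=> //; exists v.
have cov_le : #|covered tau (F' :\: N)| + #|S| <= #|covered tau F'|.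
  rewrite -(cardsID S (covered tau F')) (setIidPr Scov) addnC leq_add2l.
  apply/subset_leq_card/subsetP => v /bigcupP[e].
  rewrite !in_setD => /andP[eN eF'] ve.
  apply/andP; split; last by apply/bigcupP; exists e.
  by apply: contra eN => vS; apply/touchingP; split=> //; exists v.
have not_heavy : ~~ heavy (F' :\: N).
  apply: contra N_neq0 => /F'_min/(_ (subsetDl _ _))/setDidPl.
  by rewrite -setI_eq0 (setIidPr NF').
have cardF' := cardsID N F'; rewrite (setIidPr NF') in cardF'.
by move: F'_heavy not_heavy; rewrite /heavy -leqNgt -cardF'; nia.
Qed.

(* A Gyori-Katona-Lemons type bound *)
Lemma has_ipath_of_card (V E : finType) (tau : E -> {set V}) (F : {set E}) l s :
  3 <= l -> l + 3 <= s ->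
  {in F, forall e, s <= #|tau e|.+1} ->
  {in F &, forall e f, e != f -> s <= #|tau e :|: tau f|} ->
  l.-1 * #|covered tau F| < s * #|F| -> has_ipath tau F l.
Proof.
move=> l_ge3 s_ge card_tau card_tauU /exists_expanding.
case=> F' [/subsetP F'F F'_neq0 F'_exp].
have /has_ipathP[w /and3P[sw uw Fw] wl] : has_ipath tau F' l.
  apply: has_ipath_expanding F'_exp => //; first by move=> e /F'F; apply: card_tau.
  by move=> e f /F'F eF /F'F; apply: card_tauU.
apply/has_ipathP; exists w => //; apply/and3P; split=> //.
by apply: subset_trans Fw _; apply/subsetP.
Qed.

(** * Berge copies *)

Section BergeCopies.
Variable V : finType.
Implicit Types (G : sgraph) (W : {set V}) (H : {set {set V}}).

Lemma edgesP G (e : {set G}) :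
  reflect (exists x y, adj x y /\ e = [set x; y]) (e \in edges G).
Proof.
apply: (iffP imsetP) => [[[x y]]|[x [y [xy ->]]]].
  by rewrite inE => xy ->; exists x, y.
by exists (x, y); rewrite ?inE.
Qed.

Definition berge_map G W H (f : G -> V) (phi : {set G} -> {set V}) :=
  [/\ injective f, forall x, f x \in W, {in edges G &, injective phi}
    & forall e, e \in edges G -> phi e \in H /\ f @: e \subset phi e].

Definition berge_in G W H := exists (f : G -> V) phi, berge_map W H f phi.

Lemma contains_bergeP G H : reflect (berge_in G setT H) (contains_berge G H).
Proof.
apply: (iffP existsP) => [[X /andP[/subsetP XH /existsP[f /existsP[phi]]]]|].
  case/and4P=> /injectiveP f_inj /dinjectiveP phi_inj /eqP def_X /forall_inP f_phi.
  exists f, phi; split=> // e eG; split; last exact: f_phi.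
  by apply: XH; rewrite -def_X imset_f.
move=> [f [phi [f_inj _ phi_inj f_phi]]].
exists (phi @: edges G); apply/andP; split.
  by apply/subsetP => _ /imsetP[e /f_phi[] + _ ->].
apply/existsP; exists (finfun f); apply/existsP; exists (finfun phi).
apply/and4P; split.
- by apply/injectiveP => x y; rewrite !ffunE => /f_inj.
- by apply/dinjectiveP => d e dG eG; rewrite !ffunE; apply: phi_inj.
- by apply/eqP; apply: eq_imset => e; rewrite ffunE.
- apply/forall_inP => e /f_phi[_]; rewrite ffunE.
  by rewrite (eq_imset (g := f)) // => x; rewrite ffunE.
Qed.

Lemma berge_inS G W W' H H' :
  W \subset W' -> H \subset H' -> berge_in G W H -> berge_in G W' H'.
Proof.
move=> /subsetP WW' /subsetP HH' [f [phi [f_inj fW phi_inj f_phi]]].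
exists f, phi; split=> // [x|e /f_phi[phiH sub_phi]]; first exact: WW'.
by split=> //; apply: HH'.
Qed.

Lemma berge_in_shrink G W H : berge_in G W H -> exists W' H',
  [/\ berge_in G W' H', W' \subset W, H' \subset H, #|W'| <= #|G|
    & #|H'| <= #|edges G|].
Proof.
move=> [f [phi [f_inj fW phi_inj f_phi]]].
exists (f @: setT), (phi @: edges G); split.
- exists f, phi; split=> // [x|e eG]; first exact: imset_f.
  by split; [apply: imset_f | have [] := f_phi e eG].
- by apply/subsetP => _ /imsetP[x _ ->].
- by apply/subsetP => _ /imsetP[e /f_phi[phiH _] ->].
- by rewrite -cardsT leq_imset_card.
- exact: leq_imset_card.
Qed.

Lemma edges_hom G G' (h : G -> G') e :
  {homo h : x y / adj x y} -> e \in edges G -> h @: e \in edges G'.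
Proof.
move=> h_adj /edgesP[x [y [/h_adj xy ->]]].
by apply/edgesP; exists (h x), (h y); rewrite imsetU !imset_set1.
Qed.

Lemma berge_map_hom G G' (h : G -> G') W W' H (f : G' -> V) phi :
  injective h -> {homo h : x y / adj x y} -> (forall x, f (h x) \in W') ->
  berge_map W H f phi -> berge_in G W' H.
Proof.
move=> h_inj h_adj fW' [f_inj _ phi_inj f_phi].
exists (f \o h), (fun e : {set G} => phi (h @: e)); split=> //.
- exact: inj_comp.
- move=> d e dG eG eq_phi; apply: (imset_inj h_inj).
  by apply: phi_inj eq_phi; apply: edges_hom.
- by move=> e /(edges_hom h_adj)/f_phi; rewrite imset_comp.
Qed.

Lemma edges_dunion G G' (e : {set dunion G G'}) : e \in edges (dunion G G') ->
  (exists2 d, d \in edges G & e = inl @: d) \/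
  (exists2 d, d \in edges G' & e = inr @: d).
Proof.
case/edgesP=> -[x|x] [[y|y]] [//= xy ->]; [left|right]; exists [set x; y].
- by apply/edgesP; exists x, y.
- by rewrite imsetU !imset_set1.
- by apply/edgesP; exists x, y.
- by rewrite imsetU !imset_set1.
Qed.

Lemma berge_in_dunion G G' W W' H H' : [disjoint W & W'] -> [disjoint H & H'] ->
  berge_in G W H -> berge_in G' W' H' ->
  berge_in (dunion G G') (W :|: W') (H :|: H').
Proof.
move=> disW disH [f [phi [f_inj fW phi_inj f_phi]]].
case=> f' [phi' [f_inj' fW' phi_inj' f_phi']].
pose F (z : dunion G G') := match z with inl x => f x | inr x => f' x end.
pose Phi (e : {set dunion G G'}) :=
  if inl @^-1: e == set0 then phi' (inr @^-1: e) else phi (inl @^-1: e).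
have PhiL d : d \in edges G -> Phi (inl @: d) = phi d.
  case/edgesP=> x [y [_ ->]]; rewrite /Phi ifN.
    by congr phi; apply/setP => z; rewrite in_set (mem_imset _ _ inl_inj).
  by apply/set0Pn; exists x; rewrite in_set imset_f ?set21.
have PhiR d : d \in edges G' -> Phi (inr @: d) = phi' d.
  move=> _; rewrite /Phi ifT.
    by congr phi'; apply/setP => z; rewrite in_set (mem_imset _ _ inr_inj).
  by apply/eqP/setP => z; rewrite !in_set; apply/imsetP => -[].
exists F, Phi; split.
- move=> [x|x] [y|y] /= eq_f.
  + by rewrite (f_inj _ _ eq_f).
  + by have := disjointFr disW (fW x); rewrite eq_f fW'.
  + by have := disjointFr disW (fW y); rewrite -eq_f fW'.
  + by rewrite (f_inj' _ _ eq_f).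
- by case=> x; rewrite inE ?fW ?fW' ?orbT.
- move=> d e /edges_dunion[][{}d dG ->] /edges_dunion[][{}e eG ->];
    rewrite ?PhiL ?PhiR // => eq_phi.
  + by rewrite (phi_inj d e).
  + by have := disjointFr disH (f_phi d dG).1; rewrite eq_phi (f_phi' e eG).1.
  + by have := disjointFr disH (f_phi e eG).1; rewrite -eq_phi (f_phi' d dG).1.
  + by rewrite (phi_inj' d e).
- move=> e /edges_dunion[][{}e eG ->]; rewrite ?PhiL ?PhiR // -imset_comp inE.
  + by have [-> sub_phi] := f_phi e eG.
  + by have [-> sub_phi] := f_phi' e eG; rewrite orbT.
Qed.

Lemma berge_in_copies0 G W H : berge_in (copies 0 G) W H.
Proof.
have absurd (A : Type) (z : copies 0 G) : A by case: z => [[]].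
exists (absurd _), (fun _ => set0); split=> [x|x|d e|e]; try exact: absurd.
  by case/edgesP=> x; apply: absurd.
by case/edgesP=> x; apply: absurd.
Qed.

Lemma berge_in_copiesS G c W W' H H' : [disjoint W & W'] -> [disjoint H & H'] ->
  berge_in G W H -> berge_in (copies c G) W' H' ->
  berge_in (copies c.+1 G) (W :|: W') (H :|: H').
Proof.
move=> disW disH inG in_copies.
have [f [phi f_phi]] := berge_in_dunion disW disH inG in_copies.
have [_ fW _ _] := f_phi.
pose h (z : copies c.+1 G) : dunion G (copies c G) :=
  if unlift ord0 z.1 is Some i then inr (i, z.2) else inl z.2.
apply: (berge_map_hom (h := h)) f_phi => [[i x] [j y]|[i x] [j y]|x];
  last exact: fW.
- rewrite /h /=; case: unliftP => [i'|] ->; case: unliftP => [j'|] -> //.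
    by case=> -> ->.
  by case=> ->.
- rewrite /h /= /copies_adj => /andP[/= /eqP<- xy].
  by case: unliftP => [i'|] _ //=; rewrite /copies_adj eqxx.
Qed.

(* Greedy embedding: [fits c W H] says that there is still room for [c] copies
   once the vertices of [W] and the hyperedges of [H] have been used up. *)
Lemma berge_in_copies_greedy G H (fits : nat -> {set V} -> {set {set V}} -> Prop) :
  (forall c W0 H0, fits c.+1 W0 H0 -> exists W X, [/\ berge_in G W X,
     [disjoint W & W0], X \subset H :\: H0 & fits c (W0 :|: W) (H0 :|: X)]) ->
  forall c W0 H0, fits c W0 H0 -> berge_in (copies c G) (~: W0) (H :\: H0).
Proof.
move=> step; elim=> [|c IHc] W0 H0 fit; first exact: berge_in_copies0.
have [W [X [inG disW XH fit']]] := step _ _ _ fit.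
apply: berge_inS (berge_in_copiesS _ _ inG (IHc _ _ fit')).
- by rewrite subUset -disjoints_subset disW setCS subsetUl.
- by rewrite subUset XH setDS // subsetUl.
- by rewrite disjoints_subset setCK subsetUr.
- by rewrite disjoint_sym disjoints_subset setDE subIset // setCS subsetUr orbT.
Qed.

Lemma contains_berge_dunion G G' W H : berge_in G W H ->
  (forall W0 H0, W0 \subset W -> #|W0| <= #|G| -> #|H0| <= #|edges G| ->
     berge_in G' (~: W0) (H :\: H0)) ->
  contains_berge (dunion G G') H.
Proof.
move=> /berge_in_shrink[W0 [H0 [inG W0W H0H W0_le H0_le]]] inG'.
apply/contains_bergeP.
apply: berge_inS (subsetT _) _ (berge_in_dunion _ _ inG (inG' _ _ W0W W0_le H0_le)).
- by rewrite subUset H0H subsetDl.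
- by rewrite disjoints_subset setCK.
- by rewrite disjoint_sym disjoints_subset setDE subIset // subxx orbT.
Qed.

End BergeCopies.

(** * Paths and stars as rooted trees *)

Definition connected (G : sgraph) := forall x y : G, connect (@adj G) x y.

Section RootedTree.
Variables (l : nat) (parent : nat -> nat) (e : rel 'I_l.+1).
Hypotheses (e_sym : symmetric e) (e_irr : irreflexive e).
Hypothesis parent_le : forall j, parent j.+1 <= j.
Hypothesis e_parent : forall i j : 'I_l.+1, i < j -> e i j = (i == parent j :> nat).
Let G := SGraph e_sym e_irr.

Definition tree_parent (j : 'I_l) : 'I_l.+1 := inord (parent j.+1).
Definition tree_edge (j : 'I_l) : {set G} := [set tree_parent j; lift ord0 j].

Lemma val_tree_parent j : tree_parent j = parent j.+1 :> nat.
Proof. by rewrite inordK // ltnS (leq_trans (parent_le j)) // ltnW. Qed.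

Lemma adj_tree_parent j : e (tree_parent j) (lift ord0 j).
Proof. by rewrite e_parent val_tree_parent lift0 ?ltnS ?eqxx. Qed.

Lemma edges_tree : edges G = [set tree_edge j | j : 'I_l].
Proof.
apply/setP => d; apply/idP/imsetP => [/edgesP[x [y [xy ->]]]|[j _ ->]]; last first.
  apply/edgesP; exists (tree_parent j), (lift ord0 j).
  by split=> //; apply: adj_tree_parent.
have xy_parent (u v : 'I_l.+1) :
    u < v -> e u v -> exists2 j, j \in 'I_l & [set u; v] = tree_edge j.
  case: (unliftP ord0 v) => [j ->|-> //] lt_uv; rewrite e_parent // => /eqP def_u.
  exists j => //; rewrite /tree_edge; congr [set _; _].
  by apply: val_inj; rewrite /= val_tree_parent def_u lift0.
have [lt_xy|lt_yx|/val_inj eq_xy] := ltngtP (x : nat) y.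
- exact: xy_parent.
- by rewrite setUC; apply: xy_parent; rewrite // e_sym.
- by move: xy; rewrite /= eq_xy e_irr.
Qed.

Lemma max_tree_edge j : \max_(i in tree_edge j) (i : 'I_l.+1) = j.+1.
Proof.
rewrite big_setU1 /= ?big_set1 ?lift0 ?val_tree_parent.
  by apply/maxn_idPr; rewrite ltnW // ltnS.
by rewrite in_set1; apply: contraTneq (adj_tree_parent j) => ->; rewrite e_irr.
Qed.

Lemma card_edges_tree : #|edges G| = l.
Proof.
rewrite edges_tree card_imset ?card_ord // => i j eq_ij; apply: val_inj.
by have := max_tree_edge i; rewrite eq_ij max_tree_edge => -[].
Qed.

Lemma connected_tree : connected G.
Proof.
have to_root (x : G) : connect e x ord0.
  have [n] := ubnP (x : 'I_l.+1); elim: n x => // n IHn x; rewrite ltnS => x_le.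
  case: (unliftP ord0 (x : 'I_l.+1)) => [j def_x|->]; last exact: connect0.
  apply: (@connect_trans _ _ (tree_parent j)).
    by apply: connect1; rewrite e_sym def_x adj_tree_parent.
  apply: IHn; apply: leq_trans x_le.
  by rewrite def_x lift0 val_tree_parent ltnS.
move=> x y; apply: connect_trans (to_root x) _.
by rewrite (sym_connect_sym e_sym); apply: to_root.
Qed.

Lemma berge_in_tree (V : finType) (W : {set V}) (H : {set {set V}}) v0 e0 vs es :
  size vs = l.+1 -> size es = l -> uniq vs -> uniq es ->
  {subset vs <= W} -> {subset es <= H} ->
  (forall j, j < l -> nth v0 vs j.+1 \in nth e0 es j /\
     nth v0 vs (parent j.+1) \in nth e0 es j) ->
  berge_in G W H.
Proof.
move=> size_vs size_es uniq_vs uniq_es vsW esH incl.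
pose f (x : G) := nth v0 vs (x : 'I_l.+1).
pose phi (d : {set G}) := nth e0 es (\max_(i in d) (i : 'I_l.+1)).-1.
have phiE j : phi (tree_edge j) = nth e0 es j by rewrite /phi max_tree_edge.
exists f, phi; split.
- move=> x y /eqP; rewrite nth_uniq ?size_vs ?ltn_ord // => /eqP; exact: val_inj.
- by move=> x; apply: vsW; rewrite mem_nth ?size_vs ?ltn_ord.
- rewrite edges_tree => _ _ /imsetP[i _ ->] /imsetP[j _ ->]; rewrite !phiE => /eqP.
  by rewrite nth_uniq ?size_es ?ltn_ord // => /eqP/val_inj->.
- rewrite edges_tree => _ /imsetP[j _ ->]; rewrite phiE.
  have [jP parentP] := incl j (ltn_ord j).
  split; first by apply: esH; rewrite mem_nth ?size_es ?ltn_ord.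
  rewrite imsetU !imset_set1 subUset !sub1set /f lift0 jP andbT.
  by rewrite val_tree_parent.
Qed.

End RootedTree.

Lemma path_adj_parent l (i j : 'I_l.+1) :
  i < j -> path_adj i j = (i == j.-1 :> nat).
Proof. by rewrite /path_adj; lia. Qed.

Lemma star_adj_parent l (i j : 'I_l.+1) :
  i < j -> star_adj i j = (i == 0 :> nat).
Proof. by rewrite /star_adj -!(inj_eq val_inj) /=; lia. Qed.

Lemma card_edges_path l : #|edges (path_graph l)| = l.
Proof.
exact: (card_edges_tree _ _ (parent := predn) leqnn (@path_adj_parent l)).
Qed.

Lemma connected_path l : connected (path_graph l).
Proof. exact: (connected_tree (parent := predn) leqnn (@path_adj_parent l)). Qed.

Lemma card_edges_star l : #|edges (star_graph l)| = l.
Proof.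
exact: (card_edges_tree _ _ (parent := fun=> 0) leq0n (@star_adj_parent l)).
Qed.

Lemma connected_star l : connected (star_graph l).
Proof. exact: (connected_tree (parent := fun=> 0) leq0n (@star_adj_parent l)). Qed.

(** * Finding paths and stars *)

Section PathsAndStars.
Variable V : finType.
Implicit Types (H X : {set {set V}}) (K W Y Z : {set V}) (c v : V) (e : {set V}).

Lemma berge_in_path H K l s : 3 <= l -> l + 3 <= s ->
  {in H, forall e, s <= #|e :\: K|.+1} ->
  {in H &, forall e f, e != f -> s <= #|(e :|: f) :\: K|} ->
  l.-1 * #|V| < s * #|H| -> berge_in (path_graph l) (~: K) H.
Proof.
move=> l_ge3 s_ge card_HK card_HKU lt_H; pose tau e := e :\: K.
have /has_ipathP[w0 iw0 w0l] : has_ipath tau H l.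
  apply: has_ipath_of_card l_ge3 s_ge card_HK _ _.
    by move=> e f eH fH ef; rewrite -setDUl card_HKU.
  by apply: leq_ltn_trans lt_H; rewrite leq_mul2l max_card orbT.
have [|e eH|x [p [y [iw Xw]]]] := ipath_add_ends iw0; rewrite ?w0l //; first lia.
  by have := card_HK e eH; rewrite /tau; lia.
have /and3P[/= path_w uniq_w Hw] := iw.
set w := rcons p (inl y) in iw Xw path_w uniq_w Hw.
have size_es : size (hyperedges w) = l by rewrite -w0l -Xw card_edge_set.
have last_w : last (inl x) w = inl y by rewrite last_rcons.
have [] := nth_incident x set0 path_w last_w.
rewrite size_es => size_vs incl.
apply: (berge_in_tree _ _ (parent := predn) leqnn (@path_adj_parent l) (v0 := x)
  (e0 := set0) (vs := x :: vertices w) (es := hyperedges w)) => //.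
- by rewrite /= size_vs.
- exact: (vertices_uniq (w := inl x :: w)).
- exact: (hyperedges_uniq (w := inl x :: w)).
- move=> v /(nthP x)[[_ <-|i]]; rewrite in_setC.
    by have [|] := incl 0; [lia | rewrite inE => /andP[]].
  by rewrite /= size_vs => /incl[_ +] <-; rewrite inE => /andP[].
- move=> e; rewrite mem_hyperedges => ew; apply: (subsetP Hw).
  by rewrite in_set in_cons ew orbT.
- by move=> i /incl; rewrite !inE => -[/andP[_ ->] /andP[_ ->]].
Qed.

Definition deg H v := #|[set e in H | v \in e]|.

Lemma sum_card_setI H W : \sum_(e in H) #|e :&: W| = \sum_(v in W) deg H v.
Proof.
under eq_bigr => e _ do rewrite -sum1_card.
rewrite (exchange_big_dep (fun v => v \in W)) /=; last first.
  by move=> e v _; rewrite inE => /andP[].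
apply: eq_bigr => v vW; rewrite /deg -sum1_card.
by apply: eq_bigl => e; rewrite !inE vW andbT.
Qed.

Lemma exists_deg_ge H K l s : {in H, forall e, s <= #|e :\: K|} ->
  l.-1 * #|V| < s * #|H| -> exists2 c, c \notin K & l <= deg H c.
Proof.
move=> card_HK lt_H; apply/exists_inP; apply: contraTT lt_H => /exists_inPn deg_lt.
rewrite -leqNgt mulnC -sum_nat_const.
apply: (@leq_trans (\sum_(e in H) #|e :&: ~: K|)).
  by apply: leq_sum => e eH; rewrite -setDE card_HK.
rewrite sum_card_setI; apply: (@leq_trans (\sum_(v in ~: K) l.-1)).
  by apply: leq_sum => v; rewrite in_setC => /deg_lt; lia.
by rewrite sum_nat_const mulnC leq_mul2l max_card orbT.
Qed.

Lemma card_touching_le H W D :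
  {in W, forall v, deg H v <= D} -> #|touching id H W| <= #|W| * D.
Proof.
move=> deg_le; apply: (@leq_trans (\sum_(e in H) #|e :&: W|)); last first.
  by rewrite sum_card_setI -sum_nat_const; apply: leq_sum.
rewrite -sum1_card big_mkcond [X in _ <= X]big_mkcond /=; apply: leq_sum => e _.
by rewrite inE; case: (e \in H) => //=; case: eqVneq => //; rewrite card_gt0.
Qed.

(* The leaves of a star centred at [c], each paired with its hyperedge *)
Definition star_seq H W c (ps : seq (V * {set V})) :=
  [&& uniq (c :: unzip1 ps), uniq (unzip2 ps)
    & all (fun p => [&& p.1 \in p.2 :&: W, c \in p.2 & p.2 \in H]) ps].

Lemma berge_in_star_seq H W c ps :
  star_seq H W c ps -> berge_in (star_graph (size ps)) (c |: W) H.
Proof.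
case/and3P=> uniq_vs uniq_es /allP psP.
apply: (berge_in_tree _ _ (parent := fun=> 0) leq0n (@star_adj_parent _) (v0 := c)
  (e0 := set0) (vs := c :: unzip1 ps) (es := unzip2 ps)) => //.
- by rewrite /= size_map.
- by rewrite size_map.
- move=> v; rewrite in_setU1 in_cons => /predU1P[->|]; first by rewrite eqxx.
  by case/mapP=> p /psP/and3P[/setIP[_ pW] _ _] ->; rewrite pW orbT.
- by move=> e /mapP[p /psP/and3P[_ _ pH] ->].
- move=> j j_lt; rewrite /= !(nth_map (c, set0)) //.
  by have /psP/and3P[/setIP[]] := mem_nth (c, set0) j_lt.
Qed.

Lemma berge_in_star H W c l :
  (forall Y, #|Y| <= l ->
     l <= #|[set e in H | (c \in e) && ~~ (e :&: W \subset Y)]|) ->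
  berge_in (star_graph l) (c |: W) H.
Proof.
move=> many_edges.
have grow j : j <= l -> exists2 ps, star_seq H W c ps & size ps = j.
  elim: j => [_|j IHj j_lt]; first by exists [::].
  have [ps /and3P[uniq_vs uniq_es psP] size_ps] := IHj (ltnW j_lt).
  pose Y := [set x in c :: unzip1 ps].
  have Y_le : #|Y| <= l.
    by rewrite cardsE (leq_trans (card_size _)) //= size_map size_ps.
  have [e] : exists2 e, e \in [set e in H | (c \in e) && ~~ (e :&: W \subset Y)] &
      e \notin unzip2 ps.
    apply/subsetPn; apply: contraTN (many_edges Y Y_le) => /subset_leq_card le_ps.
    rewrite -ltnNge (leq_ltn_trans le_ps) // (leq_ltn_trans (card_size _)) //.
    by rewrite size_map size_ps.
  rewrite in_set => /and3P[eH ce /subsetPn[v veW vY]] es_e.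
  exists ((v, e) :: ps); last by rewrite /= size_ps.
  move: vY uniq_vs; rewrite /star_seq in_set !inE /= negb_or.
  case/andP=> vc -> /andP[cps ->].
  by rewrite in_cons negb_or eq_sym vc cps es_e uniq_es veW ce eH.
by have [ps /berge_in_star_seq + size_ps] := grow l (leqnn l); rewrite size_ps.
Qed.

Lemma berge_in_star_low_degree H K W0 H0 l s D : 0 < l -> l < s ->
  {in H, forall e, s <= #|e :\: K|} -> {in ~: K, forall v, deg H v <= D} ->
  l.-1 * #|V| + s * (#|H0| + #|W0| * D) < s * #|H| ->
  berge_in (star_graph l) (~: W0) (H :\: H0).
Proof.
move=> l_gt0 ls card_HK deg_le lt_H.
pose touch := touching id H (W0 :\: K); pose H' := H :\: (H0 :|: touch).
have touch_le : #|touch| <= #|W0| * D.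
  apply: leq_trans (card_touching_le (D := D) _) _.
    by move=> v; rewrite inE => /andP[vK _]; rewrite deg_le // in_setC.
  by rewrite leq_mul2r subset_leq_card ?subsetDl ?orbT.
have H'_ge : #|H| <= #|H'| + (#|H0| + #|W0| * D).
  rewrite -(cardsID (H0 :|: touch) H) addnC leq_add2l.
  by apply: leq_trans (subset_leq_card (subsetIr _ _)) _; apply: leq_card_setU_add.
have H'P e : e \in H' -> [/\ e \in H, e \notin H0 & e :&: (W0 :\: K) = set0].
  rewrite in_setD in_setU negb_or => /andP[/andP[eH0 +] eH].
  by rewrite in_set eH negbK => /eqP.
have [||c cK c_deg] := @exists_deg_ge H' K l s.
- by move=> e /H'P[/card_HK].
- by nia.
have cW0 : c \notin W0.
  have /card_gt0P[e] := leq_trans l_gt0 c_deg.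
  rewrite in_set => /andP[/H'P[_ _ /setP/(_ c) eW0] ce].
  by move: eW0; rewrite !inE ce cK => /negbT.
apply: (@berge_inS _ _ (c |: ~: (K :|: W0)) _ H').
- by rewrite subUset sub1set in_setC cW0 setCS subsetUr.
- by apply: setDS; apply: subsetUl.
apply: berge_in_star => Y Y_le; apply: leq_trans c_deg _; apply: subset_leq_card.
apply/subsetP => e; rewrite in_set => /andP[eH' ce]; rewrite in_set eH' ce /=.
have [/card_HK card_e _ eW0] := H'P e eH'.
apply: contraL card_e => /subset_leq_card le_Y; rewrite -ltnNge.
have -> : e :\: K = e :&: ~: (K :|: W0).
  apply/setP => v; move/setP/(_ v): eW0; rewrite !inE.
  by case: (v \in e) (v \in K) (v \in W0) => [] [] [].
by apply: leq_ltn_trans le_Y _; apply: leq_ltn_trans ls.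
Qed.

Lemma berge_in_star_high_degree H Z H0 c l :
  l + #|H0| + 2 ^ (#|Z| + l) <= deg H c ->
  berge_in (star_graph l) (c |: ~: Z) (H :\: H0).
Proof.
move=> c_deg; apply: berge_in_star => Y Y_le.
pose excluded := H0 :|: powerset (Z :|: Y).
have excluded_le : #|excluded| <= #|H0| + 2 ^ (#|Z| + l).
  by apply: leq_card_setU_add; rewrite card_powerset leq_exp2l // leq_card_setU_add.
have le_deg : l <= #|[set e in H | c \in e] :\: excluded|.
  rewrite -(leq_add2r #|excluded|); apply: leq_trans (_ : deg H c <= _); first lia.
  rewrite /deg -(cardsID excluded [set e in H | c \in e]) addnC leq_add2l.
  by apply: subset_leq_card; apply: subsetIr.
apply: leq_trans le_deg _; apply/subset_leq_card/subsetP => e.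
rewrite !in_set negb_or => /andP[/andP[-> eZY] /andP[-> ->]] /=.
apply: contra eZY => /subsetP eY; apply/subsetP => v ve; rewrite in_setU.
by case vZ : (v \in Z) => //=; apply: eY; rewrite !inE ve vZ.
Qed.

Lemma berge_in_stars_low_degree H K l s D : 0 < l -> l < s ->
  {in H, forall e, s <= #|e :\: K|} -> {in ~: K, forall v, deg H v <= D} ->
  forall j W0 H0,
  l.-1 * #|V| + s * (#|H0| + j * l + (#|W0| + j * l.+1) * D) < s * #|H| ->
  berge_in (copies j (star_graph l)) (~: W0) (H :\: H0).
Proof.
move=> l_gt0 ls card_HK deg_le.
apply: berge_in_copies_greedy => j W0 H0 lt_H.
have [|W [X [inW W_W0 X_H]]] := berge_in_shrink
  (berge_in_star_low_degree (H0 := H0) (W0 := W0) l_gt0 ls card_HK deg_le _).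
  by apply: leq_ltn_trans lt_H; rewrite leq_add2l leq_mul2l; nia.
rewrite card_ord card_edges_star => W_le X_le; exists W, X; split=> //.
  by rewrite disjoints_subset.
have WU := leq_card_setU_add W0 W_le.
have XU := leq_card_setU_add H0 X_le.
apply: leq_ltn_trans lt_H; rewrite leq_add2l leq_mul2l; apply/orP; right.
rewrite leq_add //; first by rewrite mulSn; lia.
by rewrite leq_mul2r mulSn; apply/orP; right; lia.
Qed.

Lemma berge_in_stars_high_degree H K l N :
  {in K, forall v, l + N + 2 ^ (#|K| + N + l) <= deg H v} ->
  forall j W0 H0, j <= #|K :\: W0| -> #|W0| + j * l.+1 <= N -> #|H0| + j * l <= N ->
  berge_in (copies j (star_graph l)) (~: W0) (H :\: H0).
Proof.
move=> deg_ge j W0 H0 jK W0N H0N.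
pose fits j (W0 : {set V}) (H0 : {set {set V}}) :=
  [/\ j <= #|K :\: W0|, #|W0| + j * l.+1 <= N & #|H0| + j * l <= N].
apply: (berge_in_copies_greedy (fits := fits)); last by split.
move=> {jK W0N H0N}j {}W0 {}H0 [jK W0N H0N].
have /set0Pn[v] : K :\: W0 != set0 by rewrite -card_gt0; lia.
rewrite inE => /andP[vW0 vK].
have card_KW0 : #|K :|: W0| <= #|K| + N.
  by apply: leq_card_setU_add; lia.
have [|W [X [inW /subsetP WvKW0 X_H]]] := berge_in_shrink
  (@berge_in_star_high_degree H (K :|: W0) H0 v l _).
  apply: leq_trans (deg_ge v vK); apply: leq_add; first by lia.
  by rewrite leq_exp2l // leq_add2r.
rewrite card_ord card_edges_star => W_le X_le; exists W, X; split=> //.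
  rewrite disjoints_subset; apply/subsetP => u /WvKW0; rewrite !inE negb_or.
  by case/predU1P=> [->|/andP[]].
have WU := leq_card_setU_add W0 W_le.
have XU := leq_card_setU_add H0 X_le.
split; rewrite ?mulSn in W0N H0N; try lia.
have := cardsD1 v (K :\: W0); rewrite inE vK vW0 => def_j.
have : #|(K :\: W0) :\ v| <= #|K :\: (W0 :|: W)|; last by lia.
apply/subset_leq_card/subsetP => u; rewrite !inE negb_or => /and3P[uv -> uK].
by rewrite uK andbT; apply/negP => /WvKW0; rewrite !inE (negPf uv) uK.
Qed.

End PathsAndStars.

(** * Upper bound *)

Definition path_stars l1 l2 t := dunion (path_graph l1) (copies t (star_graph l2)).

Section UpperBound.
Variables (V : finType) (l1 l2 t s : nat).
Hypotheses (l1_ge3 : 3 <= l1) (l2_gt0 : 0 < l2).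
Hypotheses (l1_s : l1 + 3 <= s) (l2_s : l2 < s).
Implicit Types (H : {set {set V}}) (K : {set V}).

Definition forest_order := l1.+1 + t * l2.+1.
(* A vertex of this degree is the centre of an [l2]-star even after discarding the
   [forest_order] hyperedges in use and all hyperedges contained in the set of the
   [forest_order] vertices in use, the [t] reserved centres and the [l2] vertices
   of the star itself. *)
Definition heavy_degree := l2 + forest_order + 2 ^ (t + forest_order + l2).

Lemma contains_path_stars_light H K D :
  {in H, forall e, s <= #|e :\: K|} -> {in ~: K, forall v, deg H v <= D} ->
  (maxn l1 l2).-1 * #|V| + s * (forest_order * D.+1) < s * #|H| ->
  contains_berge (path_stars l1 l2 t) H.
Proof.
move=> card_HK deg_le lt_H.
have le_max l : l <= maxn l1 l2 -> l.-1 * #|V| <= (maxn l1 l2).-1 * #|V|.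
  by move=> le_l; rewrite leq_mul2r; apply/orP; right; lia.
apply: (@contains_berge_dunion _ _ _ (~: K)).
  apply: berge_in_path l1_ge3 l1_s _ _ _.
  - by move=> e /card_HK/leqW.
  - move=> e f /card_HK le_e _ _; apply: leq_trans le_e _.
    by apply/subset_leq_card/setSD/subsetUl.
  - apply: leq_ltn_trans lt_H; apply: leq_trans (leq_addr _ _).
    by rewrite le_max ?leq_maxl.
rewrite card_ord card_edges_path => W0 H0 _ W0_le H0_le.
apply: (berge_in_stars_low_degree l2_gt0 l2_s card_HK deg_le).
apply: leq_ltn_trans lt_H; apply: leq_add; first by rewrite le_max ?leq_maxr.
rewrite leq_mul2l (mulnS forest_order); apply/orP; right; apply: leq_add.
  by rewrite /forest_order mulnS; lia.
by rewrite leq_mul2r leq_add2r W0_le orbT.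
Qed.

Lemma contains_path_stars_heavy H K :
  #|K| = t -> {in K, forall v, heavy_degree <= deg H v} ->
  {in H, forall e, s <= #|e :\: K|.+1} ->
  {in H &, forall e f, e != f -> s <= #|(e :|: f) :\: K|} ->
  l1.-1 * #|V| < s * #|H| -> contains_berge (path_stars l1 l2 t) H.
Proof.
move=> cardK deg_ge card_HK card_HKU lt_H.
apply: (@contains_berge_dunion _ _ _ (~: K)).
  exact: berge_in_path lt_H.
rewrite card_ord card_edges_path => W0 H0 W0K W0_le H0_le.
apply: (berge_in_stars_high_degree (K := K) (N := forest_order)).
- by move=> v /deg_ge; rewrite /heavy_degree cardK.
- by rewrite (setDidPl _) ?cardK // disjoint_sym disjoints_subset.
- by rewrite leq_add2r.
- by rewrite /forest_order mulnS; lia.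
Qed.

Lemma card_le_path_stars_free r H : s = r - t + 1 -> t <= r -> uniform r H ->
  ~~ contains_berge (path_stars l1 l2 t) H ->
  s * #|H| <= (maxn l1 l2).-1 * #|V| + s * (forest_order * heavy_degree.+1).
Proof.
move=> def_s t_le_r /forall_inP/= uniH; apply: contraNT; rewrite -ltnNge => lt_H.
have card_e e : e \in H -> #|e| = r by move/uniH/eqP.
have card_setD (e K : {set V}) : #|e| <= #|e :\: K| + #|K|.
  by rewrite -(cardsID K e) addnC leq_add2l subset_leq_card ?subsetIr.
pose K := [set v | heavy_degree <= deg H v].
have [K_lt|K_ge] := ltnP #|K| t.
  apply: (contains_path_stars_light (K := K)) lt_H.
    by move=> e /card_e; have := card_setD e K; lia.
  by move=> v; rewrite !inE -ltnNge => /ltnW.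
have [K'] : exists K', K' \in [set A : {set V} | A \subset K & #|A| == t].
  by apply/set0Pn; rewrite -card_gt0 cards_draws bin_gt0.
rewrite inE => /andP[K'K /eqP card_K'].
apply: (contains_path_stars_heavy card_K').
- by move=> v /(subsetP K'K); rewrite inE.
- by move=> e /card_e; have := card_setD e K'; lia.
- move=> e f eH fH ef; have := card_setD (e :|: f) K'.
  suff: r < #|e :|: f| by lia.
  rewrite ltnNge; apply: contra ef => le_r.
  have -> : e = e :|: f by apply/eqP; rewrite eqEcard subsetUl (card_e e eH).
  by rewrite eq_sym eqEcard subsetUr (card_e f fH).
- apply: leq_ltn_trans lt_H; apply: leq_trans (leq_addr _ _).
  by rewrite leq_mul2r; apply/orP; right; lia.
Qed.

End UpperBound.

Lemma ex_berge_path_stars_le l1 l2 t r s n :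
  3 <= l1 -> 0 < l2 -> l1 + 3 <= s -> l2 < s -> s = r - t + 1 -> t <= r ->
  s * ex_berge r n (path_stars l1 l2 t) <=
    (maxn l1 l2).-1 * n + s * (forest_order l1 l2 t * (heavy_degree l1 l2 t).+1).
Proof.
move=> l1_ge3 l2_gt0 l1_s l2_s def_s t_le_r; have s_gt0 : 0 < s by lia.
rewrite mulnC -leq_divRL //; apply/bigmax_leqP => H /andP[uniH freeH].
rewrite leq_divRL // mulnC -[X in _ <= _ * X + _]card_ord.
exact: card_le_path_stars_free uniH freeH.
Qed.

(** * Lower bound *)

(* One of the [t + 1] components misses the [t] vertices of [K]. *)
Lemma berge_in_component (V : finType) (G G' : sgraph) t (K : {set V})
    (H : {set {set V}}) :
  #|K| <= t -> contains_berge (dunion G (copies t G')) H ->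
  berge_in G (~: K) H \/ berge_in G' (~: K) H.
Proof.
move=> K_le /contains_bergeP[f [phi f_phi]]; have [f_inj _ _ _] := f_phi.
pose component (x : dunion G (copies t G')) : option 'I_t :=
  if x is inr y then Some y.1 else None.
have [c c_avoids] : exists c, forall x, component x = c -> f x \in ~: K.
  have lt_K : #|component @: (f @^-1: K)| < #|{: option 'I_t}|.
    rewrite card_option card_ord ltnS (leq_trans (leq_imset_card _ _)) //.
    apply: leq_trans K_le; rewrite -(card_imset _ f_inj).
    by apply/subset_leq_card/subsetP => _ /imsetP[x + ->]; rewrite inE.
  have /subsetPn[c _ cK] : ~~ (setT \subset component @: (f @^-1: K)).
    by apply: contraTN lt_K => /subset_leq_card; rewrite cardsT -leqNgt.
  exists c => x def_c; rewrite inE; apply: contra cK => fxK.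
  by apply/imsetP; exists x; rewrite // inE.
case: c c_avoids => [i|] c_avoids; [right|left].
  apply: (berge_map_hom (h := fun y => inr (i, y) : dunion G (copies t G'))) f_phi.
  - by move=> x y [].
  - by move=> x y xy; rewrite /= /copies_adj eqxx.
  - by move=> x; apply: c_avoids.
apply: (berge_map_hom (h := fun x => inl x : dunion G (copies t G'))) f_phi => //.
  by move=> x y [].
by move=> x; apply: c_avoids.
Qed.

Section BlockHypergraph.
Variables (K J B V : finType) (h : K + J * B -> V) (D : {set B}).
Hypothesis h_inj : injective h.

(* The core [K] and the blocks [{j} * B] are embedded in [V] by [h]; a hyperedge is
   the core together with a block minus one of its vertices in [D]. *)
Definition core : {set V} := h @: [set inl x | x : K].

Definition block_edge (p : J * B) : {set V} :=
  h @: [set z | if z is inr q then (q.1 == p.1) && (q.2 != p.2) else true].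

Definition block_hypergraph : {set {set V}} := block_edge @: setX setT D.

Lemma mem_block_edge q p :
  (h (inr q) \in block_edge p) = (q.1 == p.1) && (q.2 != p.2).
Proof. by rewrite mem_imset // inE. Qed.

Lemma card_core : #|core| = #|K|.
Proof. by rewrite card_imset // card_imset //; apply: inl_inj. Qed.

Lemma card_block_edge p : #|block_edge p| = #|K| + #|B|.-1.
Proof.
rewrite card_imset //.
rewrite (_ : [set _ | _] = inl @: [set: K] :|: inr @: setX [set p.1] [set~ p.2]).
  rewrite cardsU disjoint_setI0 ?cards0 ?subn0.
    rewrite card_imset ?card_imset; try exact: inl_inj; try exact: inr_inj.
    by rewrite cardsX cards1 mul1n cardsC1 cardsT.
  by apply/pred0P => z; apply/negP => /andP[/imsetP[x _ ->] /imsetP[y]].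
apply/setP => -[x|[j b]]; rewrite in_set in_setU.
  by rewrite imset_f.
rewrite (mem_imset _ _ inr_inj) in_setX in_set1 in_setC1.
by case: imsetP => // -[].
Qed.

Lemma uniform_block_hypergraph : uniform (#|K| + #|B|.-1) block_hypergraph.
Proof. by apply/forall_inP => _ /imsetP[p _ ->]; rewrite card_block_edge. Qed.

Lemma card_block_hypergraph : 1 < #|B| -> #|block_hypergraph| = #|J| * #|D|.
Proof.
move=> B_gt1; rewrite card_imset ?cardsX ?cardsT // => -[j b] [j' b'] eq_edge.
have /card_gt0P[o] : 0 < #|[set~ b]| by rewrite cardsC1; lia.
rewrite in_setC1 => ob.
have := mem_block_edge (j, o) (j, b); rewrite eq_edge mem_block_edge /= eqxx ob.
case/andP=> /eqP def_j _; rewrite -{}def_j in eq_edge *.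
have := mem_block_edge (j, b) (j, b).
by rewrite eq_edge mem_block_edge /= !eqxx /= => /negbFE/eqP->.
Qed.

(* A connected Berge copy off the core stays inside one block. *)
Lemma card_edges_block (G : sgraph) : connected G ->
  berge_in G (~: core) block_hypergraph -> #|edges G| <= #|D|.
Proof.
move=> G_conn [f [phi [_ f_core phi_inj f_phi]]].
have [->|/set0Pn[e0 e0G]] := eqVneq (edges G) set0; first by rewrite cards0.
pose in_block j := [pred x | [exists b, f x == h (inr (j, b))]].
have phi_block j e x : e \in edges G -> x \in e -> in_block j x ->
    exists2 b, b \in D & phi e = block_edge (j, b).
  move=> eG xe /existsP[o /eqP fx].
  have [/imsetP[[j' b] + def_e] /subsetP f_e] := f_phi e eG.
  rewrite in_setX => /andP[_ bD]; have := f_e (f x) (imset_f f xe).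
  by rewrite fx def_e mem_block_edge /= => /andP[/eqP-> _]; exists b.
have block_phi j b e y :
    e \in edges G -> y \in e -> phi e = block_edge (j, b) -> in_block j y.
  move=> eG ye def_e; have [_ /subsetP f_e] := f_phi e eG.
  have := f_e (f y) (imset_f f ye); rewrite def_e => /imsetP[[z|[j' o]] + fy].
    by have := f_core y; rewrite fy in_setC imset_f // imset_f.
  rewrite in_set => /andP[/= /eqP def_j _]; rewrite def_j in fy.
  by apply/existsP; exists o; rewrite fy.
have /edgesP[x0 [y0 [_ def_e0]]] := e0G.
have /imsetP[[j b0] _ phi_e0] := (f_phi e0 e0G).1.
have x0_block : in_block j x0.
  by apply: (block_phi j b0 e0); rewrite // def_e0 set21.
have all_block x : in_block j x.
  have closed_block : closed (@adj G) (in_block j).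
    apply: intro_closed => [|y z yz y_block]; first exact/sym_connect_sym/adj_sym.
    have yzG : [set y; z] \in edges G by apply/edgesP; exists y, z.
    have [b _ def_yz] := phi_block _ _ _ yzG (set21 y z) y_block.
    exact: block_phi yzG (set22 y z) def_yz.
  rewrite -[in_block j x]/(x \in in_block j).
  by rewrite -(closed_connect closed_block (G_conn x0 x)).
rewrite -(card_in_imset phi_inj).
apply: leq_trans (leq_imset_card (fun b => block_edge (j, b)) _).
apply/subset_leq_card/subsetP => _ /imsetP[e eG ->].
have /edgesP[x [y [_ def_e]]] := eG.
have [|b bD ->] := phi_block _ _ x eG _ (all_block x); first by rewrite def_e set21.
exact: imset_f.
Qed.

End BlockHypergraph.

Lemma leq_ex_berge (G G' : sgraph) t q m s n :
  connected G -> connected G' -> m < #|edges G| -> m < #|edges G'| ->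
  m <= s -> 1 < s -> t + q * s <= n ->
  m * q <= ex_berge (t + s.-1) n (dunion G (copies t G')).
Proof.
move=> G_conn G'_conn ltG ltG' ms s_gt1 tqs_n.
have card_n : #|{: 'I_t + 'I_q * 'I_s}| <= n.
  by rewrite card_sum card_prod !card_ord.
pose h z : 'I_n := widen_ord card_n (enum_rank z).
have h_inj : injective h by move=> y z /(congr1 val)/= /val_inj/enum_rank_inj.
pose D : {set 'I_s} := widen_ord ms @: 'I_m.
have card_D : #|D| = m by rewrite card_imset ?card_ord // => x y [] /val_inj.
have := card_block_hypergraph D h_inj.
rewrite !card_ord card_D mulnC => /(_ s_gt1)<-.
apply: (leq_bigmax_cond (F := fun H : {set {set 'I_n}} => #|H|)).
have := uniform_block_hypergraph D h_inj; rewrite !card_ord => -> /=.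
apply/negP => /(@berge_in_component _ _ _ _ (core h)).
rewrite card_core // card_ord.
by case=> // [/(card_edges_block h_inj G_conn)|/(card_edges_block h_inj G'_conn)];
  rewrite card_D leqNgt ?ltG ?ltG'.
Qed.

Theorem theorem2p4 (k l1 l2 r : nat) (hk : 2 <= k) (hl1 : 3 <= l1)
    (hl2 : 2 <= l2) (hr : l1 + l2 + k - 1 <= r) :
  exists C : rat, exists N : nat, forall n : nat, N <= n ->
    let ex := ex_berge r n
      (dunion (path_graph l1) (copies (k - 1) (star_graph l2))) in
    (minn l1 l2 - 1) * ((n - k + 1) %/ (r - k + 2)) <= ex /\
    (ex%:R <= ((maxn l1 l2 - 1) * n)%:R / (r - k + 2)%:R + C :> rat)%R.
Proof.
pose t := k - 1; pose s := r - k + 2.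
pose C := forest_order l1 l2 t * (heavy_degree l1 l2 t).+1.
exists C%:R%R, k => n kn ex; rewrite -/s; split.
  have def_r : r = t + s.-1 by rewrite /t /s; lia.
  rewrite /ex [X in ex_berge X]def_r.
  apply: leq_ex_berge; rewrite ?card_edges_path ?card_edges_star /s; try lia.
  - exact: connected_path.
  - exact: connected_star.
have s_gt0 : (0 < s%:R :> rat)%R by rewrite ltr0n /s; lia.
rewrite -(ler_pM2r s_gt0) mulrDl divfK ?gt_eqF // -!natrM -natrD ler_nat.
rewrite mulnC (mulnC C) subn1; apply: ex_berge_path_stars_le; rewrite /s /t; lia.
Qed.
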